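(* Let $m\ge2$ and let $G$ be the complete multipartite graph $K_{n_1\ldots n_m}$, not a complete graph, and let $n:=n_1+\dots+n_m$. Suppose that $$n_1=\dots=n_k>n_{k+1}\ge\dots\ge n_m.$$ Then $$\dim_2^S(G)=\dim_2^J(G)=n-k,\qquad \dim_2^E(G)=\min(n-k,\,n-2).$$
   Context: All graphs are finite and simple. $K_{n_1\ldots n_m}$ has vertex set partitioned into parts of sizes $n_1,\dots,n_m\ge1$, two vertices being adjacent iff they lie in different parts; it is complete iff all $n_i=1$. A Euclidean representation of a graph $G$ in $\mathbb R^d$ (as a two-distance set) is an injective map $f:V(G)\to\mathbb R^d$ for which there are real numbers $b\ge a>0$ with $\|f(u)-f(v)\|=a$ if $uv$ is an edge of $G$ and $\|f(u)-f(v)\|=b$ if $u\ne v$ and $uv$ is not an edge. The number $\dim_2^E(G)$ is the smallest $d$ such that $G$ has a Euclidean representation in $\mathbb R^d$. Such a representation is spherical if $f(V(G))$ lies on a $(d-1)$-dimensional sphere (of some radius) in $\mathbb R^d$; $\dim_2^S(G)$ is the smallest $d$ such that $G$ has a spherical representation in $\mathbb R^d$. A J-spherical representation of $G$ in $\mathbb R^d$ is a Euclidean representation with $a=\sqrt2$ (and some $b\ge\sqrt2$) whose image affinely spans $\mathbb R^d$ and lies on the unit sphere $\mathbb S^{d-1}\subset\mathbb R^d$ centered at the origin. Every non-complete graph $G$ has such a representation, unique up to isometry; its dimension $d$ is denoted $\dim_2^J(G)$. *)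

(* Defs.v *)
From HB Require Import structures.
From mathcomp Require Import all_boot all_order all_algebra.
From mathcomp Require Import reals.

Set Implicit Arguments.
Unset Strict Implicit.
Unset Printing Implicit Defensive.

Import Order.TTheory GRing.Theory Num.Theory.

Local Open Scope ring_scope.

Record graph : Type := Graph {
  vertex :> finType;
  adj : rel vertex;
  adj_sym : symmetric adj;
  adj_irrefl : irreflexive adj
}.

Definition complete (G : graph) : Prop :=
  forall u v : G, u != v -> adj u v.

Section Multipartite.
Variables (m : nat) (n : 'I_m -> nat).

(* The vertex [Tagged _ j] with tag [i] is the [j]-th vertex of part [i]. *)
Definition multipartite_vertex : finType := {i : 'I_m & 'I_(n i)}.

Definition multipartite_adj : rel multipartite_vertex :=
  fun u v => tag u != tag v.

Lemma multipartite_adj_sym : symmetric multipartite_adj.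
Proof. by move=> u v; rewrite /multipartite_adj eq_sym. Qed.

Lemma multipartite_adj_irrefl : irreflexive multipartite_adj.
Proof. by move=> u; rewrite /multipartite_adj eqxx. Qed.

Definition multipartite : graph :=
  Graph multipartite_adj_sym multipartite_adj_irrefl.

End Multipartite.

Section Representations.
Variable R : realType.

(* The norm that mathcomp-analysis puts on row vectors is the sup norm, hence
   this explicit Euclidean norm. *)
Definition enorm (d : nat) (x : 'rV[R]_d) : R :=
  Num.sqrt (\sum_(i < d) x 0 i ^+ 2).

Definition two_distance_rep (G : graph) (d : nat) (f : G -> 'rV[R]_d)
    (a b : R) : Prop :=
  [/\ injective f,
      0 < a,
      a <= b,
      forall u v : G, adj u v -> enorm (f u - f v) = a
    & forall u v : G, u != v -> ~~ adj u v -> enorm (f u - f v) = b].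

Definition euclidean_rep (G : graph) (d : nat) (f : G -> 'rV[R]_d) : Prop :=
  exists a b : R, two_distance_rep f a b.

Definition on_sphere (T : Type) (d : nat) (f : T -> 'rV[R]_d)
    (c : 'rV[R]_d) (r : R) : Prop :=
  forall v : T, enorm (f v - c) = r.

Definition spherical_rep (G : graph) (d : nat) (f : G -> 'rV[R]_d) : Prop :=
  euclidean_rep f /\
  exists (c : 'rV[R]_d) (r : R), 0 < r /\ on_sphere f c r.

Definition affinely_spans (T : finType) (d : nat) (f : T -> 'rV[R]_d) : Prop :=
  forall x : 'rV[R]_d, exists c : T -> R,
    \sum_v c v = 1 /\ x = \sum_v c v *: f v.

Definition J_spherical_rep (G : graph) (d : nat) (f : G -> 'rV[R]_d) : Prop :=
  [/\ exists b : R, two_distance_rep f (Num.sqrt 2) b,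
      affinely_spans f
    & on_sphere f 0 1].

Definition smallest (P : nat -> Prop) (d : nat) : Prop :=
  P d /\ forall d' : nat, P d' -> (d <= d')%N.

(* The three dimensions are given as relations "the dimension of G is d", so
   that no default value is needed when a representation does not exist. *)
Definition is_dim2E (G : graph) (d : nat) : Prop :=
  smallest (fun d' => exists f : G -> 'rV[R]_d', euclidean_rep f) d.

Definition is_dim2S (G : graph) (d : nat) : Prop :=
  smallest (fun d' => exists f : G -> 'rV[R]_d', spherical_rep f) d.

(* Not a minimum: affine spanning makes d the dimension of the representation
   itself, and [unique] says that every J-spherical representation has it. *)
Definition is_dim2J (G : graph) (d : nat) : Prop :=
  unique (fun d' => exists f : G -> 'rV[R]_d', J_spherical_rep f) d.

End Representations.

(* Main.v *)
Require Import Defs.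
From HB Require Import structures.
From mathcomp Require Import all_boot all_order all_algebra.
From mathcomp Require Import reals.
From mathcomp Require Import ring lra zify.

(** Let the parts have sizes n_i and let f realize the squared distances alpha
    between different parts and beta >= alpha inside a part.  For weights x on
    the vertices, with total S and part sums s_i, everything is governed by
      sum_v x_v |f u - f v|^2 = alpha S + (beta - alpha) s_(tag u) - beta x_u,
    and, when S = 0, by
      2 |sum_v x_v f v|^2 = beta sum_v x_v^2 - (beta - alpha) sum_i s_i^2.

    Lower bounds.  The dimension is bounded below by the number of vertices
    minus the dimension of the space of relations sum_v x_v f v = 0.  Along a
    relation with S = 0, or along any relation between the vectors from the
    centre of a sphere containing the points, the first sum does not depend on
    u, so beta x_u = (beta - alpha) s_(tag u) + lambda for a constant lambda.
    If one part sum vanishes then lambda = 0, and each part gives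
    (beta - (beta - alpha) n_i) s_i = 0.  The second identity, applied to the
    difference of the centroids of two parts, says
    2 (beta - alpha) <= beta (1/n_i + 1/n_j), hence beta > (beta - alpha) n_j
    as soon as part j is not among the largest ones.  So a relation is
    determined by its sums over the k largest parts.  This gives
    [spherical_card_le]: n <= d + k.  For a Euclidean representation the
    condition S = 0 replaces one of these sums, but at least one part sum is
    still needed to kill lambda; hence n <= d + max(k, 2) in
    [euclidean_card_le].

    The J-spherical representation.  There the origin is an affine combination
    of the points, and this relation forces beta = (beta - 2) n_i for some i;
    positivity makes it hold for the largest n_i.  Then the points of each of
    the k largest parts sum to 0, which are k independent relations, so that
    d <= n - k.  Conversely, with this beta the matrix 1 - D/2 is positive
    semidefinite and has these k relations, so it is a Gram matrix in dimension
    n - k.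

    The Euclidean dimension.  For k >= 2 the J-spherical representation is
    optimal.  For k = 1 one more dimension is gained: taking beta = 1 and
    alpha = 1 - g, where g is a value beyond 1/n_1 but below the other 1/n_i
    at which sum_i n_i / (1 - g n_i) = 0, the weights 1 / (1 - g n_i) have total 0 and
    constant potential, so the points satisfy a further affine relation and
    fit in dimension n - 2. *)

Set Implicit Arguments.
Unset Strict Implicit.
Unset Printing Implicit Defensive.

Import Order.TTheory GRing.Theory Num.Theory.

Local Open Scope ring_scope.

(** * Factorization of positive semidefinite matrices *)

Section GramMatrices.
Variable R : rcfType.

Definition psd n (M : 'M[R]_n) : Prop :=
  forall x : 'rV[R]_n, 0 <= (x *m M *m x^T) 0 0.

Lemma delta_mul_entry n (M : 'M[R]_n) i j :
  ((delta_mx 0 i : 'rV_n) *m M *m (delta_mx 0 j : 'rV_n)^T) 0 0 = M i j.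
Proof. by rewrite -rowE trmx_delta -colE !mxE. Qed.

Lemma qformDZ n (M : 'M[R]_n) (x y : 'rV[R]_n) c :
  ((x + c *: y) *m M *m (x + c *: y)^T) 0 0 =
  (x *m M *m x^T) 0 0 + c * ((x *m M *m y^T) 0 0 + (y *m M *m x^T) 0 0)
    + c ^+ 2 * (y *m M *m y^T) 0 0.
Proof.
rewrite linearD /= linearZ /= !(mulmxDl, mulmxDr) -!(scalemxAl, scalemxAr).
set A := (x *m M *m x^T); set B := (x *m M *m y^T).
set C := (y *m M *m x^T); set E := (y *m M *m y^T).
rewrite !mxE; ring.
Qed.

(** If the diagonal vanishes, the form takes the opposite values 2 M i j and
    - 2 M i j at e_i + e_j and e_i - e_j. *)
Lemma psd_diag_gt0 n (M : 'M[R]_n) :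
  M^T = M -> psd M -> M != 0 -> exists i, 0 < M i i.
Proof.
move=> symM posM nzM.
have diag_ge0 i : 0 <= M i i by rewrite -delta_mul_entry; apply: posM.
case: (pickP (fun i => M i i != 0)) => [i Mii|diag0].
  by exists i; rewrite lt_def Mii diag_ge0.
case/eqP: nzM; apply/matrixP=> i j; rewrite mxE.
have symE : M j i = M i j by rewrite -{1}symM mxE.
have := posM (delta_mx 0 i + 1 *: delta_mx 0 j).
have := posM (delta_mx 0 i + (-1) *: delta_mx 0 j).
rewrite !qformDZ !delta_mul_entry symE.
move/eqP: (diag0 i) => ->; move/eqP: (diag0 j) => ->; lra.
Qed.

(** Symmetric Gaussian elimination: subtracting the rank one matrix
    (column i)(row i) / M i i at a positive diagonal entry leaves a positive
    semidefinite Schur complement of smaller rank. *)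
Lemma psd_factor r n (M : 'M[R]_n) :
  M^T = M -> psd M -> (\rank M <= r)%N -> exists F : 'M[R]_(n, r), F *m F^T = M.
Proof.
elim: r M => [|r IHr] M symM posM rankM.
  exists 0; rewrite mul0mx; apply/esym/eqP.
  by rewrite -mxrank_eq0 -leqn0.
have [->|nzM] := eqVneq M 0; first by exists 0; rewrite mul0mx.
have [i Mii] := psd_diag_gt0 symM posM nzM.
set p := M i i in Mii; have p_neq0 : p != 0 by rewrite gt_eqF.
have colT : (col i M)^T = row i M by rewrite tr_col symM.
pose M' := M - p^-1 *: (col i M *m row i M).
have symM' : M'^T = M'.
  rewrite /M' linearB /= linearZ /= trmx_mul colT -colT trmxK symM //.
have posM' : psd M'.
  move=> x; pose c := (x *m col i M) 0 0.
  (* This translate of x minimizes the form along the line x + R e_i. *)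
  have := posM (x + (- (c / p)) *: delta_mx 0 i).
  have -> : (x *m M' *m x^T) 0 0 = (x *m M *m x^T) 0 0 - c ^+ 2 / p.
    rewrite /M' mulmxBr mulmxBl -scalemxAr -scalemxAl [LHS]mxE; congr (_ + _).
    rewrite mxE [X in - X]mxE mulrC; congr (- (_ / _)).
    rewrite mulmxA -(mulmxA (x *m col i M)) mxE big_ord1 expr2; congr (_ * _).
    by rewrite -colT -trmx_mul mxE.
  have cE : (x *m M *m (delta_mx 0 i : 'rV_n)^T) 0 0 = c.
    by rewrite trmx_delta -mulmxA -colE.
  have cE' : ((delta_mx 0 i : 'rV_n) *m M *m x^T) 0 0 = c.
    by rewrite -rowE -colT -trmx_mul mxE.
  rewrite qformDZ delta_mul_entry cE cE' -/p -addrA.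
  suff -> : - (c / p) * (c + c) + (- (c / p)) ^+ 2 * p = - (c ^+ 2 / p) by [].
  by field.
have ltM' : (M' < M)%MS.
  have M'E : M' = (1%:M - p^-1 *: (col i M *m delta_mx 0 i)) *m M.
    by rewrite mulmxBl mul1mx -scalemxAl -mulmxA -rowE.
  (* e_i is in the right kernel of M' but not in that of M. *)
  rewrite ltmxE {1}M'E submxMl /=; apply/negP => /submxP [A MA].
  have : col i M = A *m col i M' by rewrite !colE mulmxA -MA.
  suff -> : col i M' = 0.
    by rewrite mulmx0 => /matrixP /(_ i 0); rewrite !mxE => /eqP; rewrite gt_eqF.
  apply/matrixP=> j l; rewrite !mxE big_ord1 !mxE -/p; by field.
have [F' F'E] := IHr M' symM' posM' (leq_trans (rank_ltmx ltM') rankM).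
exists (row_mx ((Num.sqrt p)^-1 *: col i M) F' : 'M_(n, 1 + r)).
rewrite (tr_row_mx ((Num.sqrt p)^-1 *: col i M) F').
rewrite (mul_row_col ((Num.sqrt p)^-1 *: col i M) F').
rewrite F'E linearZ /= colT -scalemxAl -scalemxAr scalerA -invfM -expr2.
by rewrite sqr_sqrtr ?(ltW Mii)// /M' addrC subrK.
Qed.

End GramMatrices.

(** * Relations, Gram matrices and squared distances in finite families *)

Section Families.
Variables (R : rcfType) (T : finType).

Definition family_mx d (h : T -> 'rV[R]_d) : 'M[R]_(#|T|, d) :=
  \matrix_(i < #|T|) h (enum_val i).

Lemma sum_enum (V : nmodType) (F : T -> V) :
  \sum_(i < #|T|) F (enum_val i) = \sum_u F u.
Proof.
by rewrite -(big_enum_val F).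
Qed.

Lemma mul_family_mx d (h : T -> 'rV[R]_d) (c : T -> R) :
  (\row_i c (enum_val i)) *m family_mx h = \sum_u c u *: h u.
Proof.
rewrite mulmx_sum_row -[RHS]sum_enum; apply: eq_bigr => i _.
by rewrite rowK mxE.
Qed.

Definition independent (I : finType) (K : I -> T -> R) : Prop :=
  forall y : I -> R, (forall u, \sum_i y i * K i u = 0) -> forall i, y i = 0.

(** The relations of f embed in R^q through q linear tests that separate them,
    so they have dimension at most q. *)
Lemma card_le_rank d q (f : T -> 'rV[R]_d) (g : 'I_q -> T -> R) :
  (forall x : T -> R, \sum_u x u *: f u = 0 ->
     (forall i, \sum_u x u * g i u = 0) -> forall u, x u = 0) ->
  (#|T| <= \rank (family_mx f) + q)%N.
Proof.
move=> indep; pose G := family_mx (fun u => \row_i g i u).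
have free : row_free (row_mx (family_mx f) G).
  apply: inj_row_free => v; rewrite mul_mx_row.
  pose x u := v 0 (enum_rank u).
  have vE : v = \row_i x (enum_val i).
    by apply/rowP=> i; rewrite mxE /x enum_valK.
  rewrite vE !mul_family_mx => xfg0.
  have [xf0 xg0] := eq_row_mx (etrans xfg0 (esym (row_mx0 _ _ _ _))).
  have x0 : forall u, x u = 0.
    apply: indep => // i; have /rowP /(_ i) := xg0.
    rewrite summxE mxE => {2}<-; apply: eq_bigr => u _.
    by rewrite !mxE.
  by apply/rowP=> i; rewrite !mxE x0.
rewrite -[X in (X <= _)%N](eqP free) -mxrank_tr tr_row_mx -addsmxE.
apply: leq_trans (mxrank_adds_leqif _ _) _; rewrite !mxrank_tr leq_add2l.
exact: rank_leq_col.
Qed.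

Lemma rank_relations d q (h : T -> 'rV[R]_d) (K : 'I_q -> T -> R) :
  independent K -> (forall i, \sum_u K i u *: h u = 0) ->
  (\rank (family_mx h) + q <= #|T|)%N.
Proof.
move=> indepK relK.
pose KM : 'M[R]_(q, #|T|) := \matrix_(i < q) \row_j K i (enum_val j).
have freeK : row_free KM.
  apply: inj_row_free => v vK0.
  have v0 : forall i, v 0 i = 0.
    apply: indepK => u; have /rowP /(_ (enum_rank u)) := vK0.
    rewrite !mxE => {2}<-; apply: eq_bigr => i _.
    by rewrite !mxE enum_rankK.
  by apply/rowP=> i; rewrite mxE v0.
rewrite -[X in (_ + X)%N](eqP freeK) addnC; apply: mulmx0_rank_max.
by apply/row_matrixP=> i; rewrite row_mul rowK mul_family_mx relK row0.
Qed.

Lemma spanning_relations d q (f : T -> 'rV[R]_d) (K : 'I_q -> T -> R) :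
  (forall x, exists c : T -> R, x = \sum_u c u *: f u) ->
  independent K -> (forall i, \sum_u K i u *: f u = 0) -> (d + q <= #|T|)%N.
Proof.
move=> spans indepK relK; suff /eqP <- : row_full (family_mx f).
  exact: rank_relations relK.
rewrite -sub1mx; apply/row_subP=> i.
have [c ->] := spans (row i 1%:M).
by rewrite -mul_family_mx submxMl.
Qed.

Definition dot d (x y : 'rV[R]_d) : R := (x *m y^T) 0 0.

Lemma dotE d (x y : 'rV[R]_d) : dot x y = \sum_i x 0 i * y 0 i.
Proof. by rewrite /dot mxE; apply: eq_bigr => i _; rewrite mxE. Qed.

Lemma dotC d (x y : 'rV[R]_d) : dot x y = dot y x.
Proof. by rewrite !dotE; apply: eq_bigr => i _; rewrite mulrC. Qed.

Lemma dot_ge0 d (x : 'rV[R]_d) : 0 <= dot x x.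
Proof. by rewrite dotE; apply: sumr_ge0 => i _; rewrite -expr2 sqr_ge0. Qed.

Lemma dot_eq0 d (x : 'rV[R]_d) : dot x x = 0 -> x = 0.
Proof.
rewrite dotE => /psumr_eq0P x0; apply/rowP=> i; rewrite mxE.
apply/eqP; rewrite -[_ == 0]orbb -mulf_eq0; apply/eqP/x0 => // j _.
by rewrite -expr2 sqr_ge0.
Qed.

Lemma dotBB d (x y : 'rV[R]_d) :
  dot (x - y) (x - y) = dot x x + dot y y - 2 * dot x y.
Proof.
rewrite !dotE mulr_sumr -!big_split -sumrN -big_split; apply: eq_bigr => i _ /=.
by rewrite !mxE; ring.
Qed.

Lemma dot_sumr d (x : T -> R) (f : T -> 'rV[R]_d) (y : 'rV[R]_d) :
  dot y (\sum_u x u *: f u) = \sum_u x u * dot y (f u).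
Proof.
rewrite /dot linear_sum /= mulmx_sumr summxE; apply: eq_bigr => u _.
by rewrite linearZ /= -scalemxAr mxE.
Qed.

Lemma dot_sum_sum d (x : T -> R) (f : T -> 'rV[R]_d) :
  dot (\sum_u x u *: f u) (\sum_u x u *: f u) =
  \sum_u \sum_v x u * x v * dot (f u) (f v).
Proof.
rewrite dot_sumr; apply: eq_bigr => u _; rewrite dotC dot_sumr mulr_sumr.
by apply: eq_bigr => v _; rewrite mulrA.
Qed.

(** Independent relations of the Gram matrix M lower its rank, hence the
    dimension in which it can be realized. *)
Lemma gram_realization q (M : T -> T -> R) (K : 'I_q -> T -> R) :
  (forall u v, M u v = M v u) ->
  (forall x : T -> R, 0 <= \sum_u \sum_v x u * x v * M u v) ->
  independent K -> (forall i v, \sum_u K i u * M u v = 0) ->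
  exists f : T -> 'rV[R]_(#|T| - q), forall u v, dot (f u) (f v) = M u v.
Proof.
move=> symM posM indepK relK.
pose A : 'M[R]_#|T| := family_mx (fun u => \row_(j < #|T|) M u (enum_val j)).
have AE i j : A i j = M (enum_val i) (enum_val j) by rewrite !mxE.
have symA : A^T = A by apply/matrixP=> i j; rewrite mxE !AE symM.
have posA : psd A.
  move=> v; pose x u := v 0 (enum_rank u); have := posM x.
  suff -> : \sum_u \sum_w x u * x w * M u w = (v *m A *m v^T) 0 0 by [].
  rewrite -mulmxA mxE -sum_enum; apply: eq_bigr => i _.
  rewrite -sum_enum [in RHS]mxE mulr_sumr; apply: eq_bigr => j _.
  by rewrite AE mxE /x !enum_valK; ring.
have rankA : (\rank A <= #|T| - q)%N.
  suff : (\rank A + q <= #|T|)%N by lia.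
  apply: rank_relations indepK _ => i; apply/rowP=> j.
  rewrite summxE mxE -[RHS](relK i (enum_val j)).
  by apply: eq_bigr => u _; rewrite !mxE.
have [F FE] := psd_factor symA posA rankA.
exists (fun u => row (enum_rank u) F) => u v.
rewrite -[u in RHS]enum_rankK -[v in RHS]enum_rankK -AE -FE dotE mxE.
by apply: eq_bigr => i _; rewrite !mxE.
Qed.

(** Schoenberg's criterion, with one dimension less than usual.  The matrix
    (D u u0 + D v u0 - D u v) / 2 is the Gram matrix that puts u0 at the origin;
    the base point is one relation of it, and balanced weights z of constant
    potential are another one, independent of the first since they sum to 0. *)
Lemma schoenberg (D : T -> T -> R) (u0 : T) (z : T -> R) :
  (forall u v, D u v = D v u) -> (forall u, D u u = 0) ->
  (forall x : T -> R, \sum_u x u = 0 -> \sum_u \sum_v x u * x v * D u v <= 0) ->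
  \sum_u z u = 0 -> (exists u, z u != 0) ->
  (forall v, \sum_u z u * D u v = \sum_u z u * D u u0) ->
  exists f : T -> 'rV[R]_(#|T| - 2), forall u v,
    dot (f u - f v) (f u - f v) = D u v.
Proof.
move=> symD diagD negD z_sum [u1 zu1] zD.
pose M u v := (D u u0 + D v u0 - D u v) / 2.
pose K (i : 'I_2) u : R := if i == 0 then (u == u0)%:R else z u.
have delta_sum (F : T -> R) : \sum_u (u == u0)%:R * F u = F u0.
  rewrite (bigD1 u0) //= eqxx mul1r big1 ?addr0// => u /negPf->.
  by rewrite mul0r.
have delta_sum1 : \sum_u (u == u0)%:R = 1 :> R.
  by rewrite -[RHS](delta_sum (fun=> 1)); apply: eq_bigr => u _; rewrite mulr1.
have [| | | |f fM] := @gram_realization 2 M K.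
- by move=> u v; rewrite /M (symD u v) (addrC (D u u0)).
- move=> x; pose S := \sum_u x u.
  (* Moving the total mass S of x to the base point gives balanced weights. *)
  have := negD (fun u => x u - S * (u == u0)%:R).
  rewrite sumrB -mulr_sumr delta_sum1 mulr1 subrr => /(_ erefl).
  pose L := \sum_u x u * D u u0.
  have -> : \sum_u \sum_v (x u - S * (u == u0)%:R) * (x v - S * (v == u0)%:R) * D u v
          = \sum_u \sum_v x u * x v * D u v - 2 * S * L.
    transitivity (\sum_u (x u - S * (u == u0)%:R) * (\sum_v x v * D u v - S * D u u0)).
      apply: eq_bigr => u _; rewrite -(delta_sum (D u)) [S * \sum_v _]mulr_sumr.
      by rewrite -sumrB mulr_sumr; apply: eq_bigr => v _; ring.
    under eq_bigr => u _ do rewrite mulrBl -(mulrA S).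
    rewrite sumrB -[X in _ - X]mulr_sumr.
    rewrite (delta_sum (fun u => \sum_v x v * D u v - S * D u u0)).
    rewrite diagD mulr0 subr0.
    under eq_bigr => u _ do rewrite mulrBr mulrCA.
    rewrite sumrB -mulr_sumr -/L.
    have -> : \sum_v x v * D u0 v = L by apply: eq_bigr => v _; rewrite symD.
    have -> : \sum_u x u * (\sum_v x v * D u v) = \sum_u \sum_v x u * x v * D u v.
      by apply: eq_bigr => u _; rewrite mulr_sumr; apply: eq_bigr => v _; rewrite mulrA.
    ring.
  have -> : \sum_u \sum_v x u * x v * M u v =
      S * L - (\sum_u \sum_v x u * x v * D u v) / 2.
    transitivity (\sum_u (x u * D u u0 * S + x u * L - \sum_v x u * x v * D u v) / 2).
      apply: eq_bigr => u _; rewrite /S /L !mulr_sumr -big_split -sumrB mulr_suml /=.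
      by apply: eq_bigr => v _; rewrite /M; ring.
    rewrite -mulr_suml sumrB big_split /= -!mulr_suml -/S -/L; lra.
  lra.
- move=> y yK.
  have y0 : y 0 = 0.
    transitivity (\sum_u \sum_i y i * K i u); last by rewrite big1.
    rewrite exchange_big /= big_ord_recl big_ord1 /K /= -!mulr_sumr.
    by rewrite delta_sum1 z_sum; ring.
  have y1 : y 1 = 0.
    have := yK u1; rewrite big_ord_recl big_ord1 y0 mul0r add0r /K /=.
    have -> : lift ord0 ord0 = 1 :> 'I_2 by apply/val_inj.
    by move/eqP; rewrite mulf_eq0 (negPf zu1) orbF => /eqP.
  by case=> [[|[|//]] i2]; [rewrite -y0 | rewrite -y1]; congr y; apply/val_inj.
- move=> i v; rewrite /K; case: (i == 0).
    by rewrite (delta_sum (M^~ v)) /M diagD [D u0 v]symD; ring.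
  transitivity ((\sum_u z u * D u u0 + (\sum_u z u) * D v u0 - \sum_u z u * D u v) / 2).
    rewrite mulr_suml -big_split -sumrB mulr_suml; apply: eq_bigr => u _ /=.
    by rewrite /M; ring.
  by rewrite zD z_sum; ring.
exists f => u v; rewrite dotBB !fM /M !diagD; lra.
Qed.

(** The cross terms of the squared distances add up to the inner product of
    g u with the vanishing combination. *)
Lemma potential d (x : T -> R) (g : T -> 'rV[R]_d) u :
  \sum_v x v *: g v = 0 ->
  \sum_v x v * dot (g u - g v) (g u - g v) =
  (\sum_v x v) * dot (g u) (g u) + \sum_v x v * dot (g v) (g v).
Proof.
move=> xg0; have dot0 : \sum_v x v * dot (g u) (g v) = 0.
  by rewrite -dot_sumr xg0 /dot trmx0 mulmx0 mxE.
transitivity ((\sum_v x v) * dot (g u) (g u) + \sum_v x v * dot (g v) (g v)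
   - 2 * \sum_v x v * dot (g u) (g v)).
  rewrite mulr_suml mulr_sumr -big_split -sumrB; apply: eq_bigr => v _ /=.
  by rewrite dotBB; ring.
by rewrite dot0 mulr0 subr0.
Qed.

(** The Lagrange (or Huygens) identity for moments of inertia. *)
Lemma lagrange_identity d (x : T -> R) (f : T -> 'rV[R]_d) :
  2 * dot (\sum_u x u *: f u) (\sum_u x u *: f u) =
  2 * (\sum_u x u) * (\sum_u x u * dot (f u) (f u))
  - \sum_u \sum_v x u * x v * dot (f u - f v) (f u - f v).
Proof.
rewrite dot_sum_sum; set S := \sum_u x u; set Q := \sum_u x u * _.
have -> : \sum_u \sum_v x u * x v * dot (f u - f v) (f u - f v) =
  \sum_u (x u * dot (f u) (f u) * S + x u * Q - 2 * \sum_v x u * x v * dot (f u) (f v)).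
  apply: eq_bigr => u _; rewrite /S /Q !mulr_sumr -big_split -sumrB /=.
  by apply: eq_bigr => v _; rewrite dotBB; ring.
by rewrite sumrB big_split /= -!mulr_suml -mulr_sumr -/S -/Q; ring.
Qed.

End Families.

(** * Part sums and the distances of a complete multipartite graph *)

Section PartSums.
Variables (R : realType) (m : nat) (n : 'I_m -> nat).
Let V := multipartite_vertex n.
Implicit Types (x : V -> R) (i j : 'I_m) (u v : V) (alpha beta : R).

Lemma sum_by_parts (F : V -> R) :
  \sum_v F v = \sum_i \sum_(v : V | tag v == i) F v.
Proof. exact: (partition_big (fun v : V => tag v) xpredT). Qed.

Lemma card_part i : #|[pred v : V | tag v == i]| = n i.
Proof.
rewrite -[RHS]card_ord -(card_image (f := fun j : 'I_(n i) => Tagged (fun i => 'I_(n i)) j)).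
  apply: eq_card => -[j a]; rewrite !inE; apply/eqP/imageP => [/= ji|[b _ /(congr1 tag)->//]].
  by case: i / ji; exists a.
move=> a b /eqP; rewrite -tag_eqE /tag_eq eqxx tagged_asE => /eqP //.
Qed.

Lemma sum_part_const i (c : R) :
  \sum_(v : V | tag v == i) c = (n i)%:R * c.
Proof. by rewrite sumr_const card_part mulr_natl. Qed.

Lemma card_vertex : #|{: V}| = \sum_i n i.
Proof.
rewrite -sum1_card (partition_big (fun v : V => tag v) xpredT) //=.
by apply: eq_bigr => i _; rewrite sum1_card card_part.
Qed.

Definition part_sum x i : R := \sum_(v : V | tag v == i) x v.

Lemma part_sum_sum x : \sum_i part_sum x i = \sum_v x v.
Proof. by rewrite sum_by_parts. Qed.

(** Cauchy-Schwarz inside a part. *)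
Lemma part_sum_sqr_le x i :
  part_sum x i ^+ 2 <= (n i)%:R * \sum_(v : V | tag v == i) x v ^+ 2.
Proof.
set s := part_sum x i; set Q := \sum_(v : V | _) _; set N : R := (n i)%:R.
have [n0|n_gt0] := posnP (n i).
  have -> : s = 0.
    rewrite /s /part_sum big_pred0 // => v; apply/negP=> /eqP iv.
    by case: v iv => j a /= ji; move: a; rewrite ji n0 => -[].
  by rewrite /N n0 expr0n mul0r.
have N_gt0 : 0 < N by rewrite ltr0n.
have : 0 <= \sum_(v : V | tag v == i) (N * x v - s) ^+ 2.
  by apply: sumr_ge0 => v _; rewrite sqr_ge0.
have -> : \sum_(v : V | tag v == i) (N * x v - s) ^+ 2 = N * (N * Q - s ^+ 2).
  transitivity (N ^+ 2 * Q - 2 * N * s * (\sum_(v : V | tag v == i) x v) + N * s ^+ 2);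
    last by rewrite -/(part_sum x i) -/s; ring.
  clearbody s; rewrite /Q -(sum_part_const i (s ^+ 2)) !mulr_sumr.
  by rewrite -sumrB -big_split; apply: eq_bigr => v _ /=; ring.
by rewrite pmulr_rge0 // subr_ge0.
Qed.

Definition mp_sqdist alpha beta u v : R :=
  alpha + (beta - alpha) * (tag u == tag v)%:R - beta * (u == v)%:R.

Lemma mp_sqdistC alpha beta u v :
  mp_sqdist alpha beta u v = mp_sqdist alpha beta v u.
Proof. by rewrite /mp_sqdist (eq_sym (tag u)) (eq_sym u). Qed.

Lemma mp_sqdist_id alpha beta u : mp_sqdist alpha beta u u = 0.
Proof. by rewrite /mp_sqdist !eqxx /=; ring. Qed.

Lemma sum_delta x u : \sum_v x v * (u == v)%:R = x u.
Proof.
rewrite (bigD1 u) //= eqxx mulr1 big1 ?addr0// => v.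
by rewrite eq_sym => /negPf->; rewrite mulr0.
Qed.

Lemma sum_indicator x i : \sum_v x v * (i == tag v)%:R = part_sum x i.
Proof.
rewrite /part_sum [RHS]big_mkcond; apply: eq_bigr => v _.
by rewrite eq_sym; case: eqP; rewrite ?mulr1 ?mulr0.
Qed.

Lemma mp_potential alpha beta x u :
  \sum_v x v * mp_sqdist alpha beta u v =
  alpha * (\sum_v x v) + (beta - alpha) * part_sum x (tag u) - beta * x u.
Proof.
rewrite -(sum_indicator x) -[in beta * x u](sum_delta x u) !mulr_sumr.
by rewrite -big_split -sumrB; apply: eq_bigr => v _ /=; rewrite /mp_sqdist; ring.
Qed.

(** The inertia is the weighted sum of the potentials. *)
Lemma mp_inertia alpha beta x :
  \sum_u \sum_v x u * x v * mp_sqdist alpha beta u v =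
  alpha * (\sum_v x v) ^+ 2 + (beta - alpha) * (\sum_i part_sum x i ^+ 2)
    - beta * \sum_v x v ^+ 2.
Proof.
set S := \sum_v x v.
have -> : \sum_i part_sum x i ^+ 2 = \sum_v x v * part_sum x (tag v).
  rewrite sum_by_parts; apply: eq_bigr => i _; rewrite expr2 {1}/part_sum mulr_suml.
  by apply: eq_bigr => v /eqP->.
have -> : alpha * S ^+ 2 = \sum_v x v * (alpha * S) by rewrite -mulr_suml -/S; ring.
have := mp_potential alpha beta x; rewrite -/S; clearbody S => pot.
rewrite !mulr_sumr -big_split -sumrB; apply: eq_bigr => u _ /=.
under eq_bigr => v _ do rewrite -mulrA.
by rewrite -mulr_sumr pot; ring.
Qed.

Lemma part_sum_tag (y : 'I_m -> R) i :
  part_sum (fun v => y (tag v)) i = (n i)%:R * y i.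
Proof.
by rewrite -sum_part_const; apply: eq_bigr => v /eqP->.
Qed.

Lemma sum_tag (y : 'I_m -> R) :
  \sum_(v : V) y (tag v) = \sum_i (n i)%:R * y i.
Proof.
rewrite -(part_sum_sum (fun v => y (tag v))); apply: eq_bigr => i _.
by rewrite part_sum_tag.
Qed.

Lemma enormE d (x : 'rV[R]_d) : enorm x = Num.sqrt (dot x x).
Proof. by rewrite dotE; congr Num.sqrt; apply: eq_bigr => i _; rewrite expr2. Qed.

Lemma sqr_enorm d (x : 'rV[R]_d) : enorm x ^+ 2 = dot x x.
Proof. by rewrite enormE sqr_sqrtr // dot_ge0. Qed.

Lemma mp_sqdist_neq_tag alpha beta u v :
  tag u != tag v -> mp_sqdist alpha beta u v = alpha.
Proof.
move=> uv; have : u != v by apply: contra uv => /eqP->.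
by rewrite /mp_sqdist (negPf uv) => /negPf-> /=; ring.
Qed.

Lemma mp_sqdist_eq_tag alpha beta u v :
  u != v -> tag u = tag v -> mp_sqdist alpha beta u v = beta.
Proof. by move=> /negPf uv tuv; rewrite /mp_sqdist uv tuv eqxx /=; ring. Qed.

Definition realizes d (f : V -> 'rV[R]_d) alpha beta : Prop :=
  forall u v, dot (f u - f v) (f u - f v) = mp_sqdist alpha beta u v.

Lemma realizes_of_two_distance d (f : multipartite n -> 'rV[R]_d) a b :
  two_distance_rep f a b -> realizes f (a ^+ 2) (b ^+ 2).
Proof.
move=> [_ _ _ dist_a dist_b] u v; rewrite -sqr_enorm.
have [->|uv] := eqVneq u v.
  by rewrite subrr sqr_enorm dotE big1 ?mp_sqdist_id// => i _; rewrite mxE mulr0.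
have [tuv|tuv] := eqVneq (tag u) (tag v).
  by rewrite mp_sqdist_eq_tag // dist_b //= /multipartite_adj tuv eqxx.
by rewrite mp_sqdist_neq_tag // dist_a.
Qed.

Lemma two_distance_of_realizes d (f : multipartite n -> 'rV[R]_d) alpha beta :
  0 < alpha -> alpha <= beta -> realizes f alpha beta ->
  two_distance_rep f (Num.sqrt alpha) (Num.sqrt beta).
Proof.
move=> alpha_gt0 alpha_le fD; split.
- move=> u v fuv; apply/eqP; have [//|uv] := eqVneq u v.
  have := fD u v; rewrite fuv subrr dotE big1; last first.
    by move=> i _; rewrite mxE mulr0.
  have [tuv|tuv] := eqVneq (tag u) (tag v).
    by rewrite mp_sqdist_eq_tag //; lra.
  by rewrite mp_sqdist_neq_tag //; lra.
- by rewrite sqrtr_gt0.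
- by rewrite ler_wsqrtr.
- by move=> u v uv; rewrite enormE fD mp_sqdist_neq_tag.
- move=> u v uv; rewrite /= /multipartite_adj negbK => /eqP tuv.
  by rewrite enormE fD mp_sqdist_eq_tag.
Qed.

End PartSums.

(** * Lower bounds on the dimension *)

Section Bounds.
Variables (R : realType) (m : nat) (n : 'I_m -> nat).
Let V := multipartite_vertex n.
Implicit Types (x : V -> R) (i j : 'I_m) (u v : V) (alpha beta : R).

Lemma inertia_realizes d (f : V -> 'rV[R]_d) alpha beta x :
  realizes f alpha beta ->
  2 * dot (\sum_v x v *: f v) (\sum_v x v *: f v) =
  2 * (\sum_v x v) * (\sum_v x v * dot (f v) (f v))
    - alpha * (\sum_v x v) ^+ 2 - (beta - alpha) * (\sum_i part_sum x i ^+ 2)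
    + beta * \sum_v x v ^+ 2.
Proof.
move=> fD; rewrite lagrange_identity.
under [X in _ - X]eq_bigr => u _ do under eq_bigr => v _ do rewrite fD.
by rewrite mp_inertia; ring.
Qed.

(** Up to a positive factor, the difference of the two sides is the squared
    distance between the centroids of parts i and j. *)
Lemma centroid_dist_ge0 d (f : V -> 'rV[R]_d) alpha beta i j :
  realizes f alpha beta -> i != j -> (0 < n i)%N -> (0 < n j)%N ->
  2 * (beta - alpha) * (n i)%:R * (n j)%:R <= beta * ((n i)%:R + (n j)%:R).
Proof.
move=> fD ij ni_gt0 nj_gt0; set Ni : R := (n i)%:R; set Nj : R := (n j)%:R.
have Ni_gt0 : 0 < Ni by rewrite ltr0n.
have Nj_gt0 : 0 < Nj by rewrite ltr0n.
(* The difference of the two centroids, scaled by n_i n_j. *)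
pose y (l : 'I_m) : R := if l == i then Nj else if l == j then - Ni else 0.
have yi : y i = Nj by rewrite /y eqxx.
have yj : y j = - Ni by rewrite /y eq_sym (negPf ij) eqxx.
have y0 l : l != i -> l != j -> y l = 0 by rewrite /y => /negPf-> /negPf->.
have sum_pair (F : 'I_m -> R) :
    (forall l, l != i -> l != j -> F l = 0) -> \sum_l F l = F i + F j.
  move=> F0; rewrite (bigD1 i) //= (bigD1 j) 1?eq_sym //= big1 ?addr0 //.
  by move=> l /andP[]; apply: F0.
have := inertia_realizes (fun v => y (tag v)) fD.
rewrite sum_tag (sum_pair (fun l => (n l)%:R * y l)); last first.
  by move=> l li lj; rewrite y0 // mulr0.
rewrite yi yj -/Ni -/Nj (sum_tag n (fun l => y l ^+ 2)).
rewrite (sum_pair (fun l => (n l)%:R * y l ^+ 2)); last first.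
  by move=> l li lj; rewrite y0 // expr0n mulr0.
rewrite (sum_pair (fun l => part_sum (fun v : V => y (tag v)) l ^+ 2)); last first.
  by move=> l li lj; rewrite part_sum_tag y0 // mulr0 expr0n.
rewrite !part_sum_tag yi yj -/Ni -/Nj.
set P := dot _ _; have P_ge0 : 0 <= P by apply: dot_ge0.
set Q := \sum_v _; move=> PE.
have {}PE : 2 * P = (Ni * Nj) * (beta * (Ni + Nj) - 2 * (beta - alpha) * Ni * Nj).
  by rewrite PE; ring.
have NN : 0 < Ni * Nj by apply: mulr_gt0.
by rewrite -subr_ge0 -(pmulr_rge0 _ NN) -PE mulr_ge0.
Qed.

(** If n_j did not satisfy this, then neither would the larger n_i, and the sum
    of the two reverse inequalities, one of them strict, would contradict
    [centroid_dist_ge0]. *)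
Lemma smaller_part_nondegenerate d (f : V -> 'rV[R]_d) alpha beta i j :
  realizes f alpha beta -> 0 < alpha -> alpha <= beta ->
  (0 < n j)%N -> (n j < n i)%N -> (beta - alpha) * (n j)%:R < beta.
Proof.
move=> fD alpha_gt0 alpha_le nj_gt0 nji.
have ij : i != j by apply/eqP=> ij; rewrite ij ltnn in nji.
have := centroid_dist_ge0 fD ij (ltn_trans nj_gt0 nji) nj_gt0.
have : (n j)%:R < (n i)%:R :> R by rewrite ltr_nat.
have : 0 < (n j)%:R :> R by rewrite ltr0n.
set Ni : R := (n i)%:R; set Nj : R := (n j)%:R; set g := beta - alpha.
move=> Nj_gt0 Nji cen; rewrite ltNge; apply/negP => le_g.
have beta_gt0 : 0 < beta by lra.
have g_gt0 : 0 < g by rewrite -(pmulr_lgt0 _ Nj_gt0); lra.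
have Nij : 0 < Ni + Nj by lra.
have le2 : beta * (Ni + Nj) <= g * Nj * (Ni + Nj) by rewrite ler_pM2r.
have : 2 * g * Ni * Nj <= g * Nj * (Ni + Nj) by lra.
have -> : 2 * g * Ni * Nj = g * Nj * (2 * Ni) by ring.
by rewrite ler_pM2l ?mulr_gt0//; lra.
Qed.

(** Sum the hypothesis over the part i0. *)
Lemma flat_vanish alpha beta lambda x i0 :
  (forall u, beta * x u = (beta - alpha) * part_sum x (tag u) + lambda) ->
  (0 < n i0)%N -> part_sum x i0 = 0 -> lambda = 0.
Proof.
move=> flat ni0 s0.
have /eqP : (n i0)%:R * lambda = 0.
  rewrite -sum_part_const.
  transitivity (\sum_(v : V | tag v == i0) beta * x v).
    by apply: eq_bigr => v /eqP tv; rewrite flat tv s0; ring.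
  by rewrite -mulr_sumr -/(part_sum x i0) s0 mulr0.
by rewrite mulf_eq0 pnatr_eq0 => /orP[/eqP n0|/eqP//]; rewrite n0 in ni0.
Qed.

Lemma flat_part_sum alpha beta x i :
  (forall u, beta * x u = (beta - alpha) * part_sum x (tag u)) ->
  (beta - (beta - alpha) * (n i)%:R) * part_sum x i = 0.
Proof.
move=> flat; rewrite mulrBl -mulrA (mulrC (n i)%:R) mulrA.
have -> : beta * part_sum x i = \sum_(v : V | tag v == i) (beta - alpha) * part_sum x i.
  by rewrite mulr_sumr; apply: eq_bigr => v /eqP <-.
by rewrite sum_part_const; ring.
Qed.

Section LargestParts.
Variables (k : nat) (i0 : 'I_m).
Hypotheses (n_gt0 : forall i, (0 < n i)%N)
  (i0E : i0 = 0 :> nat) (k_gt0 : (0 < k)%N) (k_le : (k <= m)%N)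
  (n_rest : forall i, (k <= i)%N -> (n i < n i0)%N).

(** A relation of constant potential that vanishes on a largest part is carried,
    up to its part sums, by the k largest parts. *)
Lemma flat_rest_eq0 d (f : V -> 'rV[R]_d) alpha beta lambda x :
  realizes f alpha beta -> 0 < alpha -> alpha <= beta ->
  (forall u, beta * x u = (beta - alpha) * part_sum x (tag u) + lambda) ->
  part_sum x i0 = 0 ->
  (forall u, beta * x u = (beta - alpha) * part_sum x (tag u)) /\
  (forall i, (k <= i)%N -> part_sum x i = 0).
Proof.
move=> fD alpha_gt0 alpha_le flat s0.
have lambda0 := flat_vanish flat (n_gt0 i0) s0.
have flat0 u : beta * x u = (beta - alpha) * part_sum x (tag u).
  by rewrite flat lambda0 addr0.
split=> // i ki; have /eqP := flat_part_sum i flat0; rewrite mulf_eq0.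
have := smaller_part_nondegenerate fD alpha_gt0 alpha_le (n_gt0 i) (n_rest ki).
by rewrite -subr_gt0 => /gt_eqF-> /eqP.
Qed.

Lemma flat_eq0 alpha beta x :
  0 < beta -> (forall u, beta * x u = (beta - alpha) * part_sum x (tag u)) ->
  (forall i, part_sum x i = 0) -> forall u, x u = 0.
Proof.
move=> beta_gt0 flat s0 u; apply/eqP.
by rewrite -(mulrI_eq0 _ (lregP (lt0r_neq0 beta_gt0))) flat s0 mulr0.
Qed.

(** On a sphere every relation between the vectors from the centre has constant
    potential, even when its weights are not balanced; so the k sums over the
    largest parts determine it. *)
Lemma spherical_card_le d (f : V -> 'rV[R]_d) alpha beta c rho :
  realizes f alpha beta -> 0 < alpha -> alpha <= beta ->
  (forall v, dot (f v - c) (f v - c) = rho) ->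
  (#|{: V}| <= \rank (family_mx (fun v => f v - c)%R) + k)%N.
Proof.
move=> fD alpha_gt0 alpha_le f_sph.
apply: (@card_le_rank _ _ _ _ _ (fun (l : 'I_k) v => (widen_ord k_le l == tag v)%:R)).
move=> x xf0 xs0.
have s0 i : (i < k)%N -> part_sum x i = 0.
  move=> ik; rewrite -(xs0 (Ordinal ik)) -sum_indicator.
  by apply: eq_bigr => v _; congr (_ * (_ == _)%:R); apply/val_inj.
have flat u : beta * x u = (beta - alpha) * part_sum x (tag u)
    + (alpha - 2 * rho) * (\sum_v x v).
  have := potential u xf0; rewrite f_sph.
  under eq_bigr => v _ do rewrite opprB addrA subrK fD.
  under [X in _ = _ + X -> _]eq_bigr => v _ do rewrite f_sph.
  rewrite mp_potential -mulr_suml => E.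
  rewrite -[LHS]opprK -[- (beta * _)](addKr (alpha * (\sum_v x v) +
    (beta - alpha) * part_sum x (tag u))) E; ring.
have [|flat0 rest0] := flat_rest_eq0 fD alpha_gt0 alpha_le flat; first by rewrite s0 ?i0E.
have beta_gt0 : 0 < beta by lra.
apply: (flat_eq0 beta_gt0 flat0) => i.
by have [/s0|/rest0] := ltnP i k.
Qed.

(** The total of the weights must be tested too, for the potential of an
    unbalanced relation need not be constant.  This test makes one part sum
    redundant, but not the only one when k = 1. *)
Lemma euclidean_card_le d (f : V -> 'rV[R]_d) alpha beta :
  realizes f alpha beta -> 0 < alpha -> alpha <= beta ->
  (#|{: V}| <= d + maxn k 2)%N.
Proof.
move=> fD alpha_gt0 alpha_le.
apply: leq_trans (_ : _ <= \rank (family_mx f) + maxn k 2)%N _; last first.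
  by rewrite leq_add2r rank_leq_col.
pose g (l : 'I_(maxn k 2)) v : R :=
  if l.+1 == maxn k 2 then 1 else (l == tag v :> nat)%:R.
apply: (@card_le_rank _ _ _ _ _ g) => x xf0 xg0.
have S0 : \sum_v x v = 0.
  have l_lt : ((maxn k 2).-1 < maxn k 2)%N by lia.
  transitivity (\sum_u x u * g (Ordinal l_lt) u); last exact: xg0.
  apply: eq_bigr => v _; rewrite /g /= prednK ?eqxx ?mulr1 //; lia.
have s0 i : (i.+1 < maxn k 2)%N -> part_sum x i = 0.
  move=> ik; have i_lt : (i < maxn k 2)%N by lia.
  rewrite -(xg0 (Ordinal i_lt)) -sum_indicator; apply: eq_bigr => v _.
  by rewrite /g /= ltn_eqF.
pose lambda := - (\sum_v x v * dot (f v) (f v)).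
have flat u : beta * x u = (beta - alpha) * part_sum x (tag u) + lambda.
  have := potential u xf0; under eq_bigr => v _ do rewrite fD.
  by rewrite mp_potential S0 /lambda mul0r add0r => <-; ring.
have [|flat0 rest0] := flat_rest_eq0 fD alpha_gt0 alpha_le flat.
  by rewrite s0 // i0E; lia.
have beta_gt0 : 0 < beta by lra.
have s0' i : i.+1 != maxn k 2 -> part_sum x i = 0.
  move=> ik; have [/s0//|ki] := ltnP i.+1 (maxn k 2).
  by apply: rest0; lia.
apply: (flat_eq0 beta_gt0 flat0) => i.
have [ik|/s0'//] := eqVneq i.+1 (maxn k 2).
rewrite -S0 -part_sum_sum (bigD1 i) //= big1 ?addr0 // => j ji.
by apply: s0'; apply: contra ji; rewrite -ik eqSS.
Qed.

End LargestParts.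
End Bounds.

(** * The J-spherical representation *)

Section JRep.
Variables (R : realType) (m : nat) (n : 'I_m -> nat).
Let V := multipartite_vertex n.
Implicit Types (x : V -> R) (i j : 'I_m) (u v : V) (alpha beta : R).

Definition part_indicator i v : R := (i == tag v)%:R.

Lemma sum_part_indicator i : \sum_v part_indicator i v = (n i)%:R.
Proof.
transitivity (\sum_(v : V) 1 * (i == tag v)%:R : R).
  by apply: eq_bigr => v _; rewrite mul1r.
by rewrite (sum_indicator (fun=> 1)) /part_sum sum_part_const mulr1.
Qed.

Lemma part_sum_indicator i j :
  part_sum (part_indicator i) j = (n j)%:R * (i == j)%:R.
Proof. exact: (part_sum_tag n (fun l => (i == l)%:R)). Qed.

Lemma part_sqr_norm d (f : V -> 'rV[R]_d) beta i :
  realizes f 2 beta -> (forall v, dot (f v) (f v) = 1) ->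
  let s := \sum_v part_indicator i v *: f v in
  2 * dot s s = (n i)%:R * (beta - (beta - 2) * (n i)%:R).
Proof.
move=> fD f1 /=; rewrite (inertia_realizes _ fD).
under [X in 2 * _ * X]eq_bigr => v _ do rewrite f1 mulr1.
have -> : \sum_v part_indicator i v ^+ 2 = (n i)%:R.
  rewrite -sum_part_indicator; apply: eq_bigr => v _; rewrite /part_indicator.
  by case: eqP; rewrite /= ?expr0n ?expr1n.
rewrite sum_part_indicator (bigD1 i) //= big1 => [|j ji]; last first.
  by rewrite part_sum_indicator eq_sym (negPf ji) mulr0 expr0n.
by rewrite part_sum_indicator eqxx /=; ring.
Qed.

(** At this value of beta the points of the part form a regular simplex
    inscribed in the unit sphere with its centroid at the origin. *)
Lemma part_vanish d (f : V -> 'rV[R]_d) beta i :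
  realizes f 2 beta -> (forall v, dot (f v) (f v) = 1) ->
  beta = (beta - 2) * (n i)%:R -> \sum_v part_indicator i v *: f v = 0.
Proof.
move=> fD f1 betaE; apply: dot_eq0; have := part_sqr_norm i fD f1.
by rewrite /= -betaE subrr mulr0; lra.
Qed.

Variables (k : nat) (i0 : 'I_m).
Hypotheses (n_gt0 : forall i, (0 < n i)%N)
  (i0E : i0 = 0 :> nat) (k_gt0 : (0 < k)%N) (k_le : (k <= m)%N)
  (n_first : forall i, (i < k)%N -> n i = n i0)
  (n_rest : forall i, (k <= i)%N -> (n i < n i0)%N).

Lemma n_le i : (n i <= n i0)%N.
Proof. by have [/n_first->|/n_rest/ltnW] := ltnP i k. Qed.

Lemma part_indicator_independent :
  independent (fun (l : 'I_k) v => part_indicator (widen_ord k_le l) v).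
Proof.
move=> y y0 l.
pose v : V := Tagged (fun i => 'I_(n i)) (Ordinal (n_gt0 (widen_ord k_le l))).
rewrite -[RHS](y0 v) (bigD1 l) //= big1 => [|j jl].
  by rewrite /part_indicator /= eqxx mulr1 addr0.
rewrite /part_indicator /= -val_eqE /= val_eqE (negPf jl) mulr0 //.
Qed.

(** Affine spanning enters twice: it makes d the rank of the points, and it
    provides an unbalanced relation at the origin, which determines beta. *)
Lemma J_spherical_dim d (f : multipartite n -> 'rV[R]_d) :
  J_spherical_rep f -> d = (#|{: V}| - k)%N.
Proof.
move=> [[b f_rep] f_aff f_sph].
have [_ a_gt0 a_le _ _] := f_rep.
have fD := realizes_of_two_distance f_rep.
have sqr2 : Num.sqrt 2 ^+ 2 = 2 :> R by rewrite sqr_sqrtr.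
rewrite sqr2 in fD; set beta := b ^+ 2 in fD.
have beta_ge : 2 <= beta.
  by rewrite -sqr2 /beta ler_sqr ?nnegrE ?(ltW a_gt0) // (le_trans (ltW a_gt0)).
have f1 v : dot (f v) (f v) = 1.
  by rewrite -[f v]subr0 -sqr_enorm f_sph expr1n.
have lower : (#|{: V}| <= d + k)%N.
  apply: leq_trans (_ : _ <= \rank (family_mx (fun v : V => f v - 0)%R) + k)%N _.
    by apply: (spherical_card_le n_gt0 i0E k_gt0 k_le n_rest fD) => // v; rewrite subr0.
  by rewrite leq_add2r rank_leq_col.
suff upper : (d + k <= #|{: V}|)%N by lia.
apply: (spanning_relations (f := f : V -> _) _ part_indicator_independent).
  by move=> x; have [c [_ xE]] := f_aff x; exists c.
suff betaE : beta = (beta - 2) * (n i0)%:R.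
  by move=> l; apply: part_vanish fD f1 _; rewrite n_first //=.
have [c [c1 /esym c0]] := f_aff 0.
have flat u : beta * c u = (beta - 2) * part_sum c (tag u).
  have := potential u c0.
  under eq_bigr => v _ do rewrite fD.
  under [X in _ = _ + X -> _]eq_bigr => v _ do rewrite f1.
  by rewrite mp_potential f1 -mulr_suml c1; lra.
have [i si] : exists i, part_sum c i != 0.
  case: (pickP (fun i => part_sum c i != 0)) => [i|none]; first by exists i.
  move: c1; rewrite -part_sum_sum big1 => [/esym /eqP|i _]; first by rewrite oner_eq0.
  by apply/eqP; rewrite -[_ == _]negbK none.
have /eqP := flat_part_sum i flat; rewrite mulf_eq0 (negPf si) orbF => /eqP bi.
have : 0 <= 2 * dot (\sum_v part_indicator i0 v *: f v)
                    (\sum_v part_indicator i0 v *: f v).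
  by rewrite mulr_ge0 ?dot_ge0.
rewrite (part_sqr_norm i0 fD f1) pmulr_rge0 ?ltr0n // => b0.
have : (beta - 2) * (n i)%:R <= (beta - 2) * (n i0)%:R.
  by rewrite ler_wpM2l ?subr_ge0 // ler_nat n_le.
lra.
Qed.

(** The Gram matrix is block diagonal, one block per part; beta is the value at
    which the blocks of the largest parts become singular. *)
Lemma J_spherical_exists : (2 <= n i0)%N ->
  exists f : multipartite n -> 'rV[R]_(#|{: V}| - k), J_spherical_rep f.
Proof.
move=> n0_ge2; pose N : R := (n i0)%:R; pose beta := 2 * N / (N - 1).
have N_ge2 : 2 <= N by rewrite /N ler_nat.
have N1 : N - 1 != 0 by rewrite gt_eqF //; lra.
have betaN : beta = (beta - 2) * N by rewrite /beta; field.
have beta_ge2 : 2 <= beta by rewrite /beta ler_pdivlMr; lra.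
pose M u v : R := 1 - mp_sqdist 2 beta u v / 2.
have [| | | |f fM] := @gram_realization _ _ k M
    (fun l v => part_indicator (widen_ord k_le l) v).
- by move=> u v; rewrite /M mp_sqdistC.
- move=> x; pose S := \sum_v x v.
  have -> : \sum_u \sum_v x u * x v * M u v =
      S ^+ 2 - (\sum_u \sum_v x u * x v * mp_sqdist 2 beta u v) / 2.
    rewrite expr2 {1}/S !mulr_suml -sumrB; apply: eq_bigr => u _.
    rewrite /S mulr_sumr mulr_suml -sumrB.
    by apply: eq_bigr => v _; rewrite /M; ring.
  rewrite mp_inertia -/S.
  suff : (beta - 2) * (\sum_i part_sum x i ^+ 2) <= beta * \sum_v x v ^+ 2 by lra.
  suff bound : \sum_i part_sum x i ^+ 2 <= N * \sum_v x v ^+ 2.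
    by rewrite [in leRHS]betaN -mulrA ler_wpM2l // subr_ge0.
  rewrite (sum_by_parts (fun v : V => x v ^+ 2)) mulr_sumr; apply: ler_sum => i _.
  apply: le_trans (part_sum_sqr_le x i) _; apply: ler_wpM2r.
    by apply: sumr_ge0 => v _; apply: sqr_ge0.
  by rewrite ler_nat n_le.
- exact: part_indicator_independent.
- move=> l v; set i := widen_ord k_le l.
  have ni : (n i)%:R = N :> R by rewrite /N n_first //=.
  transitivity (\sum_u part_indicator i u
                - (\sum_u part_indicator i u * mp_sqdist 2 beta v u) / 2).
    rewrite mulr_suml -sumrB; apply: eq_bigr => u _.
    by rewrite /M mp_sqdistC; ring.
  rewrite mp_potential sum_part_indicator part_sum_indicator /part_indicator.
  have [<-|_] := eqVneq i (tag v) => /=; last by rewrite ni; lra.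
  by rewrite ni; lra.
have f1 v : dot (f v) (f v) = 1 by rewrite fM /M mp_sqdist_id; lra.
have fD : realizes f 2 beta by move=> u v; rewrite dotBB !f1 fM /M; lra.
have f_sph : on_sphere f 0 1.
  by move=> v; rewrite enormE subr0 f1 sqrtr1.
exists f; split=> //.
  by exists (Num.sqrt beta); apply: two_distance_of_realizes fD; rewrite ?ltr0n.
have rank_ge : (#|{: V}| <= \rank (family_mx (fun v : V => f v - 0)%R) + k)%N.
  apply: (spherical_card_le n_gt0 i0E k_gt0 k_le n_rest fD) => //.
  by move=> v; rewrite subr0.
have full : row_full (family_mx (f : V -> _)).
  have fE : family_mx (fun v : V => f v - 0) = family_mx (f : V -> _).
    by apply/row_matrixP=> l; rewrite !rowK subr0.
  rewrite fE in rank_ge; rewrite /row_full eqn_leq rank_leq_col /=.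
  by rewrite leq_subLR addnC.
move=> x; have /row_fullP [B BF] := full.
pose c u := (x *m B) 0 (enum_rank u).
have xE : x = \sum_u c u *: f u.
  rewrite -mul_family_mx -[LHS]mulmx1 -BF mulmxA; congr (_ *m _).
  by apply/rowP=> j; rewrite [RHS]mxE /c enum_valK.
pose r := (1 - \sum_u c u) / N.
have N_neq0 : N != 0 by rewrite gt_eqF //; lra.
(* The relation on a largest part corrects the total of the coefficients. *)
exists (fun u => c u + r * part_indicator i0 u); split.
  by rewrite big_split /= -mulr_sumr sum_part_indicator -/N /r divfK // addrC subrK.
transitivity (\sum_u c u *: f u + r *: \sum_u part_indicator i0 u *: f u).
  by rewrite (part_vanish fD f1 betaN) scaler0 addr0.
rewrite scaler_sumr -big_split; apply: eq_bigr => u _ /=.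
by rewrite scalerDl scalerA.
Qed.

End JRep.

(** * Euclidean representations when the largest part is unique *)

(** Since both families have total 0, subtracting from s the multiple of t that
    cancels the term of i0 does not change the sum, and the remaining terms have
    positive denominators. *)
Lemma one_negative_weight (R : realFieldType) (I : finType) (i0 : I) (s t : I -> R) :
  (forall i, i != i0 -> 0 < t i) -> t i0 != 0 ->
  \sum_i t i = 0 -> \sum_i s i = 0 -> 0 <= \sum_i s i ^+ 2 / t i.
Proof.
move=> t_gt0 t0 t_sum s_sum; pose r := s i0 / t i0.
have t_neq0 i : t i != 0.
  by have [->//|/t_gt0/lt0r_neq0] := eqVneq i i0.
have -> : \sum_i s i ^+ 2 / t i = \sum_i (s i - r * t i) ^+ 2 / t i.
  transitivity (\sum_i s i ^+ 2 / t i - 2 * r * \sum_i s i + r ^+ 2 * \sum_i t i).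
    by rewrite s_sum t_sum; ring.
  rewrite !mulr_sumr -sumrB -big_split; apply: eq_bigr => i _ /=.
  by field.
rewrite (bigD1 i0) //= {1}/r divfK // subrr expr0n mul0r add0r.
by apply: sumr_ge0 => i /t_gt0 ti; rewrite divr_ge0 ?sqr_ge0 ?ltW.
Qed.

Section UniqueLargestPart.
Variables (R : realType) (m : nat) (n : 'I_m -> nat) (i0 i1 : 'I_m).
Let V := multipartite_vertex n.
Hypotheses (n_gt0 : forall i, (0 < n i)%N) (i10 : i1 != i0) (n10 : (n i1 < n i0)%N)
  (n_le1 : forall i, i != i0 -> (n i <= n i1)%N).

Let N i : R := (n i)%:R.

(** The sum has a pole at 1 / N i0, so the intermediate value theorem is applied
    to the polynomial Q obtained by clearing denominators. *)
Lemma degenerate_ratio : exists g : R,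
  [/\ 0 < g, g < 1, 1 - g * N i0 < 0,
      forall i, i != i0 -> 0 < 1 - g * N i
    & \sum_i N i / (1 - g * N i) = 0].
Proof.
pose e (g : R) i := 1 - g * N i.
pose Q : {poly R} := \sum_i (N i)%:P * \prod_(j | j != i) (1 - (N j)%:P * 'X).
have QE g : Q.[g] = \sum_i N i * \prod_(j | j != i) e g j.
  rewrite horner_sum; apply: eq_bigr => i _; rewrite hornerM hornerC; congr (_ * _).
  by rewrite horner_prod; apply: eq_bigr => j _; rewrite !hornerE /e mulrC.
have QE' g : (forall i, e g i != 0) -> Q.[g] = (\prod_i e g i) * \sum_i N i / e g i.
  move=> e0; rewrite QE mulr_sumr; apply: eq_bigr => i _.
  by rewrite [in RHS](bigD1 i) //=; field.
have N_gt0 i : 0 < N i by rewrite ltr0n.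
have N10 : N i1 < N i0 by rewrite ltr_nat.
have N_ge1 : 1 <= N i1 by rewrite ler1n.
have N_le1 i : i != i0 -> N i <= N i1 by move=> ?; rewrite ler_nat n_le1.
(* At the midpoint b of the poles of i0 and i1 the terms of i0 and i1 in
   the sum cancel, and the other terms are nonnegative. *)
pose a := (N i0)^-1; pose b := ((N i0)^-1 + (N i1)^-1) / 2.
have a_gt0 : 0 < a by rewrite invr_gt0.
have a_lt : a < (N i1)^-1 by rewrite ltf_pV2 ?posrE.
have ab : a < b by rewrite /b -/a; lra.
have b_lt : b < (N i1)^-1 by rewrite /b -/a; lra.
have e_gt0 g i : 0 < g -> g <= b -> i != i0 -> 0 < e g i.
  move=> g_gt0 gb ii0; rewrite subr_gt0.
  have le1 : g * N i <= g * N i1 by rewrite ler_pM2l // N_le1.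
  have : g * N i1 < (N i1)^-1 * N i1 by rewrite ltr_pM2r //; lra.
  by rewrite mulVf ?gt_eqF//; lra.
have ea0 : e a i0 = 0 by rewrite /e /a mulVf ?subrr ?gt_eqF.
have e0_lt0 g : a < g -> e g i0 < 0.
  move=> ag; have : a * N i0 < g * N i0 by rewrite ltr_pM2r.
  by rewrite /e; move: ea0; rewrite /e; lra.
have Qa : 0 < Q.[a].
  rewrite QE (bigD1 i0) //= [X in _ + X]big1 => [|i ii0]; last first.
    by rewrite (bigD1 i0) 1?eq_sym //= ea0 mul0r mulr0.
  by rewrite addr0 mulr_gt0 //; apply: prodr_gt0 => j /e_gt0; apply => //; apply: ltW.
have b_gt0 : 0 < b by lra.
have Qb : Q.[b] <= 0.
  have e_neq0 i : e b i != 0.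
    have [->|ii0] := eqVneq i i0; first by rewrite lt_eqF // e0_lt0.
    by rewrite gt_eqF // e_gt0.
  rewrite QE' //; apply: mulr_le0_ge0.
    rewrite (bigD1 i0) //= mulr_le0_ge0 ?(ltW (e0_lt0 _ _))//.
    by apply: prodr_ge0 => j /e_gt0 ej; apply/ltW/ej.
  rewrite (bigD1 i0) //= (bigD1 i1) //= addrA.
  have -> : N i0 / e b i0 + N i1 / e b i1 = 0.
    have N0 : N i0 != 0 by rewrite gt_eqF.
    have N1 : N i1 != 0 by rewrite gt_eqF.
    have N01 : N i0 - N i1 != 0 by rewrite gt_eqF // subr_gt0.
    have -> : e b i0 = - (N i0 - N i1) / (2 * N i1).
      by rewrite /e /b; field; rewrite N0 N1.
    have -> : e b i1 = (N i0 - N i1) / (2 * N i0).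
      by rewrite /e /b; field; rewrite N0 N1.
    by field; rewrite N0 N1 N01.
  rewrite add0r; apply: sumr_ge0 => j /andP[j0 _].
  by rewrite divr_ge0 ?ltW // e_gt0.
have [|g /andP[ag gb] /eqP Qg] := @poly_ivt _ (- Q) a b (ltW ab).
  by rewrite !hornerN oppr_le0 oppr_ge0 (ltW Qa) Qb.
have {}Qg : Q.[g] = 0 by apply/eqP; rewrite -oppr_eq0 -hornerN Qg.
have {}ag : a < g.
  by rewrite lt_neqAle ag andbT; apply/eqP=> ag'; move: Qa; rewrite ag' Qg ltxx.
have g_gt0 : 0 < g by lra.
have e_neq0 i : e g i != 0.
  have [->|ii0] := eqVneq i i0; first by rewrite lt_eqF // e0_lt0.
  by rewrite gt_eqF // e_gt0.
exists g; split=> //.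
- have : g * N i1 < (N i1)^-1 * N i1 by rewrite ltr_pM2r //; lra.
  rewrite mulVf ?gt_eqF// => gN.
  have : g * 1 <= g * N i1 by rewrite ler_pM2l.
  lra.
- exact: e0_lt0.
- by move=> i; apply: e_gt0.
move/eqP: Qg; rewrite QE' // mulf_eq0 => /orP[/prodf_eq0 [i _]|/eqP//].
by rewrite (negPf (e_neq0 i)).
Qed.

(** With beta = 1 and alpha = 1 - g, the weights (1 - g n_i)^-1 are balanced and
    have constant potential, while the inertia form is still nonpositive on
    balanced weights; so Schoenberg's criterion gives dimension n - 2. *)
Lemma euclidean_exists_unique_largest :
  exists f : multipartite n -> 'rV[R]_(#|{: V}| - 2), euclidean_rep f.
Proof.
have [g [g_gt0 g_lt1 e0 e_gt0 e_sum]] := degenerate_ratio.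
have e_neq0 i : 1 - g * N i != 0.
  by have [->|/e_gt0/lt0r_neq0//] := eqVneq i i0; rewrite lt_eqF.
have N_gt0 i : 0 < N i by rewrite ltr0n.
pose v0 : V := Tagged (fun i => 'I_(n i)) (Ordinal (n_gt0 i0)).
pose z (v : V) := (1 - g * N (tag v))^-1.
have z_sum : \sum_v z v = 0.
  by rewrite (sum_tag n (fun i => (1 - g * N i)^-1)).
have z_pot v : \sum_u z u * mp_sqdist (1 - g) 1 u v = - 1.
  under eq_bigr => u _ do rewrite mp_sqdistC.
  rewrite mp_potential z_sum (part_sum_tag n (fun i => (1 - g * N i)^-1)).
  rewrite -/(N _) /z; field; exact: e_neq0.
have [| | | | | |f fD] := @schoenberg R V (mp_sqdist (1 - g) 1) v0 z.
- exact: mp_sqdistC.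
- exact: mp_sqdist_id.
- move=> x x_sum; rewrite mp_inertia x_sum.
  suff : g * \sum_i part_sum x i ^+ 2 <= \sum_v x v ^+ 2 by lra.
  pose t i := N i / (1 - g * N i).
  have t_gt0 i : i != i0 -> 0 < t i by move=> /e_gt0 ei; rewrite divr_gt0.
  have t0 : t i0 != 0 by rewrite mulf_neq0 ?invr_eq0 // gt_eqF.
  have := one_negative_weight t_gt0 t0 e_sum _; move=> /(_ (part_sum x)).
  rewrite part_sum_sum => /(_ x_sum) st_ge0.
  rewrite -subr_ge0; apply: le_trans st_ge0 _.
  rewrite (sum_by_parts (fun v : V => x v ^+ 2)) mulr_sumr -sumrB; apply: ler_sum => i _.
  have -> : part_sum x i ^+ 2 / t i = part_sum x i ^+ 2 / N i - g * part_sum x i ^+ 2.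
    by rewrite /t; field; apply/andP; split; [exact: lt0r_neq0 (N_gt0 i) | exact: e_neq0].
  by rewrite lerD2r ler_pdivrMr // mulrC part_sum_sqr_le.
- exact: z_sum.
- by exists v0; rewrite invr_eq0.
- by move=> v; rewrite !z_pot.
exists f, (Num.sqrt (1 - g)), (Num.sqrt 1).
by apply: two_distance_of_realizes fD; lra.
Qed.

End UniqueLargestPart.

(** * The three dimensions *)

Lemma J_spherical_is_spherical (R : realType) (G : graph) d (f : G -> 'rV[R]_d) :
  J_spherical_rep f -> spherical_rep f.
Proof.
move=> [[b f_rep] _ f_sph]; split; first by exists (Num.sqrt 2), b.
by exists 0, 1.
Qed.

Local Close Scope ring_scope.

Theorem corollary6p1 (R : realType) (m : nat) (ns : 'I_m -> nat) (k : nat)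
  (hm : 2 <= m)
  (ns_gt0 : forall i : 'I_m, 1 <= ns i)
  (not_complete : ~ complete (multipartite ns))
  (hk : 1 <= k <= m)
  (ns_first : forall i j : 'I_m, i < k -> j < k -> ns i = ns j)
  (ns_drop : forall i j : 'I_m, i < k -> k <= j -> ns j < ns i)
  (ns_rest : forall i j : 'I_m, k <= i -> i <= j -> ns j <= ns i) :
  let n := \sum_(i < m) ns i in
  [/\ is_dim2S R (multipartite ns) (n - k),
      is_dim2J R (multipartite ns) (n - k)
    & is_dim2E R (multipartite ns) (minn (n - k) (n - 2))].
Proof.
rewrite /= -card_vertex; case/andP: hk => k_gt0 k_le.
pose V := multipartite_vertex ns; rewrite -/V.
have m_gt0 : 0 < m by lia.
pose i0 : 'I_m := Ordinal m_gt0; have i0E : i0 = 0 :> nat by [].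
have n_first (i : 'I_m) : i < k -> ns i = ns i0 by move=> ik; apply: ns_first.
have n_rest (i : 'I_m) : k <= i -> ns i < ns i0 by move=> ki; apply: ns_drop.
have n0_ge2 : 2 <= ns i0.
  rewrite leqNgt; apply/negP=> n0_lt2; apply: not_complete => u v uv.
  apply: contra uv => /eqP tuv; apply/eqP.
  have n1 i : ns i <= 1 by apply: leq_trans (n_le n_first n_rest i) _.
  case: u v tuv => [i a] [j b] /= ij; case: j / ij b => b; congr existT.
  apply/val_inj; case: a b => [a a_lt] [b b_lt] /=.
  by have := n1 i; lia.
have [f fJ] :=
  J_spherical_exists R ns_gt0 i0E k_gt0 k_le n_first n_rest n0_ge2.
have fS := J_spherical_is_spherical fJ.
split; split.
- by exists f.
- move=> d [g [[a [b g_rep]] [c [r [_ g_sph]]]]].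
  have [_ a_gt0 a_le _ _] := g_rep.
  have gD := realizes_of_two_distance g_rep.
  rewrite leq_subLR addnC.
  apply: leq_trans (_ : _ <= \rank (family_mx (fun v : V => g v - c)%R) + k) _.
    apply: (spherical_card_le ns_gt0 i0E k_gt0 k_le n_rest gD).
    + by rewrite exprn_gt0.
    + by rewrite ler_sqr // nnegrE ltW // (lt_le_trans a_gt0).
    + by move=> v; rewrite -sqr_enorm g_sph.
  by rewrite leq_add2r rank_leq_col.
- by exists f.
- by move=> d [g gJ]; rewrite (J_spherical_dim ns_gt0 i0E k_gt0 k_le n_first n_rest gJ).
- have [k2|k_lt2] := leqP 2 k.
    have -> : minn (#|V| - k) (#|V| - 2) = #|V| - k by lia.
    by exists f; case: fS.
  have -> : minn (#|V| - k) (#|V| - 2) = #|V| - 2 by lia.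
  have k1 : k = 1 by lia.
  pose i1 : 'I_m := Ordinal hm.
  apply: (@euclidean_exists_unique_largest _ _ _ i0 i1) => //.
    by apply: n_rest; rewrite k1.
  move=> i ii0; apply: ns_rest; first by rewrite k1.
  by rewrite /= lt0n.
- move=> d [g [a [b g_rep]]].
  have [_ a_gt0 a_le _ _] := g_rep.
  have gD := realizes_of_two_distance g_rep.
  have := euclidean_card_le ns_gt0 i0E k_gt0 k_le n_rest gD.
  rewrite exprn_gt0 // ler_sqr ?nnegrE ?(ltW a_gt0) ?(le_trans (ltW a_gt0)) //.
  move=> /(_ erefl a_le).
  rewrite geq_min !leq_subLR !(addnC _ d) => bound.
  have [k2|k2] := leqP 2 k.
    by rewrite -{1}(maxn_idPl k2) bound.
  by rewrite -[X in _ || (_ <= d + X)](maxn_idPr (ltnW k2)) bound orbT.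
Qed.
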